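(* Let $F\colon \mathbf{A}\to\mathbf{C}$ and $G\colon\mathbf{B}\to\mathbf{C}$ be lenses between small categories, and let the lens span $\mathbf{A}\xleftarrow{\overline{G}}\mathbf{D}\xrightarrow{\overline{F}}\mathbf{B}$ be a proxy pullback of the lens cospan $(F,G)$. If $(\overline{G},\overline{F})$ is terminal amongst the independent lens spans that are compatible with the cospan $(F,G)$, then the span $(\overline{G},\overline{F})$ is sync minimal.
   Context: All categories are small. A lens (asymmetric delta lens) $F\colon\mathbf{A}\to\mathbf{B}$ is a functor $F\colon\mathbf{A}\to\mathbf{B}$ (its get functor) together with, for each object $A$ of $\mathbf{A}$ and each morphism $b$ of $\mathbf{B}$ with source $FA$, a chosen morphism $F^{A}b$ of $\mathbf{A}$ with source $A$ (the lift of $b$), such that $F(F^{A}b)=b$, $F^{A}\mathrm{id}_{FA}=\mathrm{id}_A$, and $F^{A}(b'\circ b)=F^{A'}b'\circ F^{A}b$, where $A'$ is the target of $F^{A}b$. The composite of lenses $F\colon\mathbf{A}\to\mathbf{B}$ and $G\colon\mathbf{B}\to\mathbf{C}$ is the composite functor $G\circ F$ with lifts $(G\circ F)^{A}c=F^{A}(G^{FA}c)$. Equality of lenses (and commutativity of diagrams of lenses) means equality of both functors and lifts. $\mathbf{Lens}$ is the category of small categories and lenses. A lens span $\mathbf{A}\xleftarrow{K}\mathbf{E}\xrightarrow{J}\mathbf{B}$ is compatible with a lens cospan $\mathbf{A}\xrightarrow{F}\mathbf{C}\xleftarrow{G}\mathbf{B}$ (equivalently, the square is a compatible lens square) if $F\circ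 K=G\circ J$ as lenses, and for all objects $E$ of $\mathbf{E}$, all morphisms $a$ of $\mathbf{A}$ with source $KE$ and all morphisms $b$ of $\mathbf{B}$ with source $JE$, we have $J(K^{E}a)=G^{JE}(Fa)$ and $K(J^{E}b)=F^{KE}(Gb)$. A proxy pullback of a lens cospan $(F,G)$ is a lens span compatible with $(F,G)$ such that the underlying square of get functors is a pullback square in the category of small categories and functors. A lens span $\mathbf{A}\xleftarrow{F}\mathbf{C}\xrightarrow{G}\mathbf{B}$ is sync minimal if every morphism of $\mathbf{C}$ is a composite of a finite sequence of morphisms $c_k\colon C_k\to C_{k+1}$ of $\mathbf{C}$ such that, for each $k$, either $c_k=F^{C_k}Fc_k$ or $c_k=G^{C_k}Gc_k$. The sync-minimal core $\mathscr{M}(F,G)$ of a lens span $(F,G)$ is the lens span from $\mathbf{A}$ to $\mathbf{B}$ obtained by replacing $\mathbf{C}$ by its subcategory with the same objects and with only those morphisms that are composites of finite sequences of lifts along $F$ or $G$, with $F$ and $G$ (functors and lifts) restricted accordingly. A lens span $(F,G)$ is independent if, for all morphisms $c,c'$ in the apex of $\mathscr{M}(F,G)$ with the same source, whenever $Fc=Fc'$ and $Gc=Gc'$, also $c=c'$. The span $(\overline{G},\overline{F})$ is terminal amongst a class of lens spans from $\mathbf{A}$ to $\mathbf{B}$ if for every span $\mathbf{A}\xleftarrow{K}\mathbf{E}\xrightarrow{J}\mathbf{B}$ in the class there is a unique lens $L\colon\mathbf{E}\to\mathbf{D}$ with $\overline{G}\circ L=K$ and $\overline{F}\circ L=J$.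 *)

(* Defs.v *)
From Stdlib Require Import ProofIrrelevance FunctionalExtensionality.

Set Implicit Arguments.
Unset Strict Implicit.

(** Lenses involve equations between objects, so a small category is given by a
    type of objects and a single type of morphisms with source and target maps:
    equations between morphisms then need no transport.  Composability is a
    proof argument of [comp]; the laws are stated for all such proofs. *)
Record Category : Type := {
  Ob : Type;
  Mor : Type;
  dom : Mor -> Ob;
  cod : Mor -> Ob;
  idm : Ob -> Mor;
  comp : forall g f : Mor, cod f = dom g -> Mor;
  dom_idm : forall X, dom (idm X) = X;
  cod_idm : forall X, cod (idm X) = X;
  dom_comp : forall g f (p : cod f = dom g), dom (comp p) = dom f;
  cod_comp : forall g f (p : cod f = dom g), cod (comp p) = cod g;
  comp_idr : forall f (p : cod (idm (dom f)) = dom f), comp p = f;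
  comp_idl : forall f (p : cod f = dom (idm (cod f))), comp p = f;
  comp_assoc : forall h g f (p : cod f = dom g) (q : cod g = dom h)
    (r : cod (comp p) = dom h) (s : cod f = dom (comp q)), comp r = comp s
}.

Arguments dom {c} _.
Arguments cod {c} _.
Arguments idm {c} _.
Arguments comp {c} g f _.

Record Functor (A B : Category) : Type := {
  fobj : Ob A -> Ob B;
  fmor : Mor A -> Mor B;
  dom_fmor : forall f, dom (fmor f) = fobj (dom f);
  cod_fmor : forall f, cod (fmor f) = fobj (cod f);
  fmor_idm : forall X, fmor (idm X) = idm (fobj X);
  fmor_comp : forall g f (p : cod f = dom g) (q : cod (fmor f) = dom (fmor g)),
    fmor (comp g f p) = comp (fmor g) (fmor f) q
}.

Arguments fobj {A B} f X : rename.
Arguments fmor {A B} f m : rename.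

Definition functor_comp (A B C : Category) (G : Functor B C) (F : Functor A B) :
  Functor A C.
Proof.
refine {| fobj := fun X => fobj G (fobj F X); fmor := fun f => fmor G (fmor F f) |}.
- intros f; rewrite dom_fmor; f_equal; apply dom_fmor.
- intros f; rewrite cod_fmor; f_equal; apply cod_fmor.
- intros X; now rewrite !fmor_idm.
- intros g f p q.
  assert (r : cod (fmor F f) = dom (fmor F g))
    by (rewrite dom_fmor, cod_fmor; now f_equal).
  now rewrite (fmor_comp p r), (fmor_comp r q).
Defined.

Lemma functor_ext (A B : Category) (F G : Functor A B) :
  (forall X, fobj F X = fobj G X) -> (forall f, fmor F f = fmor G f) -> F = G.
Proof.
destruct F as [Fo Fm F1 F2 F3 F4], G as [Go Gm G1 G2 G3 G4]; simpl; intros Ho Hm.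
apply functional_extensionality in Ho, Hm; subst.
f_equal; apply proof_irrelevance.
Qed.

Record Lens (A B : Category) : Type := {
  get :> Functor A B;
  lift : forall (X : Ob A) (b : Mor B), dom b = fobj get X -> Mor A;
  dom_lift : forall X b (p : dom b = fobj get X), dom (lift p) = X;
  get_lift : forall X b (p : dom b = fobj get X), fmor get (lift p) = b;
  lift_idm : forall X (p : dom (idm (fobj get X)) = fobj get X), lift p = idm X;
  lift_comp : forall X b b' (p : dom b = fobj get X) (q : cod b = dom b')
    (r : dom (comp b' b q) = fobj get X)
    (s : dom b' = fobj get (cod (lift p)))
    (t : cod (lift p) = dom (lift s)),
    lift r = comp (lift s) (lift p) t
}.

Arguments lift {A B} l X b _.

Lemma dom_get_lift (A B C : Category) (G : Lens B C) (F : Lens A B)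
  (X : Ob A) (c : Mor C) (p : dom c = fobj G (fobj F X)) :
  dom (lift F X (lift G (fobj F X) c p) (dom_lift p)) = X.
Proof. apply dom_lift. Qed.

Lemma lift_eq (A B : Category) (F : Lens A B) (X X' : Ob A) (b b' : Mor B)
  (p : dom b = fobj F X) (p' : dom b' = fobj F X') :
  X = X' -> b = b' -> lift F X b p = lift F X' b' p'.
Proof. intros -> ->; f_equal; apply proof_irrelevance. Qed.

Lemma comp_eq (C : Category) (g g' f f' : Mor C)
  (p : cod f = dom g) (p' : cod f' = dom g') :
  g = g' -> f = f' -> comp g f p = comp g' f' p'.
Proof. intros -> ->; f_equal; apply proof_irrelevance. Qed.

Lemma get_cod_lift (A B : Category) (F : Lens A B) (X : Ob A) (b : Mor B)
  (p : dom b = fobj F X) : fobj F (cod (lift F X b p)) = cod b.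
Proof. now rewrite <- cod_fmor, get_lift. Qed.

Definition lens_comp (A B C : Category) (G : Lens B C) (F : Lens A B) : Lens A C.
Proof.
refine {| get := functor_comp G F;
          lift := fun X c (p : dom c = fobj (functor_comp G F) X) =>
            lift F X (lift G (fobj F X) c p) (dom_lift p) |}.
- intros X c p; apply dom_lift.
- intros X c p; simpl; now rewrite !get_lift.
- intros X p.
  transitivity (lift F X (idm (fobj F X)) (dom_idm _)).
  + apply lift_eq; [reflexivity | apply lift_idm].
  + apply lift_idm.
- intros X c c' p q r s t.
  set (b := lift G (fobj F X) c p).
  assert (s1 : dom c' = fobj G (cod b))
    by (unfold b; now rewrite get_cod_lift).
  set (b' := lift G (cod b) c' s1).
  assert (q' : cod b = dom b') by (symmetry; apply dom_lift).
  assert (r' : dom (comp b' b q') = fobj F X)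
    by (rewrite dom_comp; apply dom_lift).
  transitivity (lift F X (comp b' b q') r').
  + apply lift_eq; [reflexivity | apply lift_comp].
  + assert (s2 : dom b' = fobj F (cod (lift F X b (dom_lift p))))
      by (rewrite get_cod_lift; now symmetry).
    assert (t2 : cod (lift F X b (dom_lift p)) = dom (lift F _ b' s2))
      by (symmetry; apply dom_lift).
    rewrite (lift_comp r' t2).
    apply comp_eq; [| reflexivity].
    apply lift_eq; [reflexivity |].
    apply lift_eq; [| reflexivity].
    symmetry; apply get_cod_lift.
Defined.

(** Hence [=] on lenses amounts to equality of get functors and of lifts, and it
    is the equality used for commuting diagrams of lenses below. *)
Lemma lens_ext (A B : Category) (F G : Lens A B) :
  get F = get G ->
  (forall X b (p : dom b = fobj F X) (q : dom b = fobj G X),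
     lift F X b p = lift G X b q) ->
  F = G.
Proof.
destruct F as [F l F1 F2 F3 F4], G as [G m G1 G2 G3 G4]; simpl; intros <- Hl.
assert (E : l = m) by (do 3 (apply functional_extensionality_dep; intros ?); apply Hl).
subst; f_equal; apply proof_irrelevance.
Qed.

Record LensSpan (A B : Category) : Type := Span {
  apex : Category;
  lleg : Lens apex A;
  rleg : Lens apex B
}.

Arguments Span {A B apex} lleg rleg.

Definition compatible (A B C : Category) (F : Lens A C) (G : Lens B C)
  (S : LensSpan A B) : Prop :=
  let K := lleg S in
  let J := rleg S in
  lens_comp F K = lens_comp G J /\
  (forall (E : Ob (apex S)) (a : Mor A)
     (p : dom a = fobj K E) (q : dom (fmor F a) = fobj G (fobj J E)),
     fmor J (lift K E a p) = lift G (fobj J E) (fmor F a) q) /\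
  (forall (E : Ob (apex S)) (b : Mor B)
     (p : dom b = fobj J E) (q : dom (fmor G b) = fobj F (fobj K E)),
     fmor K (lift J E b p) = lift F (fobj K E) (fmor G b) q).

Definition is_pullback (A B C D : Category) (F : Functor A C) (G : Functor B C)
  (P : Functor D A) (Q : Functor D B) : Prop :=
  functor_comp F P = functor_comp G Q /\
  forall (X : Category) (P' : Functor X A) (Q' : Functor X B),
    functor_comp F P' = functor_comp G Q' ->
    exists! U : Functor X D, functor_comp P U = P' /\ functor_comp Q U = Q'.

Definition proxy_pullback (A B C : Category) (F : Lens A C) (G : Lens B C)
  (S : LensSpan A B) : Prop :=
  compatible F G S /\ is_pullback F G (lleg S) (rleg S).

Inductive composite (C : Category) (P : Mor C -> Prop) : Mor C -> Prop :=
| composite_nil (X : Ob C) : composite P (idm X)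
| composite_cons (f g : Mor C) (p : cod f = dom g) :
    P f -> composite P g -> composite P (comp g f p).

(** [c] is the chosen lift, at its own source, of its image. *)
Definition lift_of_image (C A : Category) (F : Lens C A) (c : Mor C) : Prop :=
  c = lift F (dom c) (fmor F c) (dom_fmor F c).

Definition sync_minimal (A B : Category) (S : LensSpan A B) : Prop :=
  forall c : Mor (apex S),
    composite (fun d => lift_of_image (lleg S) d \/ lift_of_image (rleg S) d) c.

Definition is_lift (C A : Category) (F : Lens C A) (c : Mor C) : Prop :=
  exists (X : Ob C) (a : Mor A) (p : dom a = fobj F X), c = lift F X a p.

Lemma composite_comp (C : Category) (P : Mor C -> Prop) (g f : Mor C)
  (p : cod f = dom g) :
  composite P f -> composite P g -> composite P (comp g f p).
Proof.
intros Hf; revert g p; induction Hf as [X | f h q Pf Hh IH]; intros g p Hg.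
- assert (E : X = dom g) by (rewrite <- p; symmetry; apply cod_idm).
  subst X; now rewrite comp_idr.
- assert (r : cod h = dom g) by (now rewrite <- p, cod_comp).
  assert (s : cod f = dom (comp g h r)) by (now rewrite dom_comp).
  rewrite (comp_assoc (p := q) (q := r) p s).
  apply composite_cons; auto.
Qed.

Lemma composite_one (C : Category) (P : Mor C -> Prop) (f : Mor C) :
  P f -> composite P f.
Proof.
intros Pf.
assert (p : cod f = dom (idm (cod f))) by (symmetry; apply dom_idm).
rewrite <- (comp_idl p).
apply composite_cons; [assumption | constructor].
Qed.

Lemma sig_ext (T : Type) (P : T -> Prop) (x y : sig P) :
  proj1_sig x = proj1_sig y -> x = y.
Proof.
destruct x, y; simpl; intros ->; f_equal; apply proof_irrelevance.
Qed.

(** The subcategory with the same objects and the morphisms that are composites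
    of morphisms satisfying [P]. *)
Definition composite_subcategory (C : Category) (P : Mor C -> Prop) : Category.
Proof.
refine {| Ob := Ob C;
          Mor := {c : Mor C | composite P c};
          dom := fun c => dom (proj1_sig c);
          cod := fun c => cod (proj1_sig c);
          idm := fun X => exist _ (idm X) (composite_nil P X);
          comp := fun g f p => exist _ (comp (proj1_sig g) (proj1_sig f) p)
            (composite_comp p (proj2_sig f) (proj2_sig g)) |}.
- intros X; apply dom_idm.
- intros X; apply cod_idm.
- intros g f p; apply dom_comp.
- intros g f p; apply cod_comp.
- intros f p; apply sig_ext; apply (comp_idr (c := C)).
- intros f p; apply sig_ext; apply (comp_idl (c := C)).
- intros h g f p q r s; apply sig_ext; apply (comp_assoc (c := C)).
Defined.

Definition restrict_functor (C A : Category) (P : Mor C -> Prop) (F : Functor C A) :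
  Functor (composite_subcategory P) A.
Proof.
refine {| fobj := fun X : Ob (composite_subcategory P) => fobj F X;
          fmor := fun c : Mor (composite_subcategory P) => fmor F (proj1_sig c) |}.
- intros f; apply (dom_fmor F).
- intros f; apply (cod_fmor F).
- intros X; apply (fmor_idm F).
- intros g f p q; apply (@fmor_comp _ _ F).
Defined.

Definition restrict_lens (C A : Category) (P : Mor C -> Prop) (F : Lens C A)
  (HP : forall c, is_lift F c -> P c) : Lens (composite_subcategory P) A.
Proof.
refine {| get := restrict_functor P F;
          lift := fun (X : Ob (composite_subcategory P)) a
              (p : dom a = fobj (restrict_functor P F) X) =>
            exist _ (lift F X a p)
              (composite_one (HP _ (ex_intro _ X (ex_intro _ a (ex_intro _ p eq_refl)))))
            : Mor (composite_subcategory P) |}.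
- intros X a p; apply (dom_lift (l := F)).
- intros X a p; apply (get_lift (l := F)).
- intros X p; apply sig_ext; apply (lift_idm (l := F)).
- intros X a a' p q r s t; apply sig_ext; apply (lift_comp (l := F)).
Defined.

Definition sync_minimal_core (A B : Category) (S : LensSpan A B) : LensSpan A B :=
  let P := fun c : Mor (apex S) => is_lift (lleg S) c \/ is_lift (rleg S) c in
  Span (restrict_lens (P := P) (fun c H => or_introl H))
       (restrict_lens (P := P) (fun c H => or_intror H)).

Definition independent (A B : Category) (S : LensSpan A B) : Prop :=
  let M := sync_minimal_core S in
  forall c c' : Mor (apex M),
    dom c = dom c' ->
    fmor (lleg M) c = fmor (lleg M) c' ->
    fmor (rleg M) c = fmor (rleg M) c' ->
    c = c'.

Definition terminal_amongst (A B : Category) (P : LensSpan A B -> Prop)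
  (S : LensSpan A B) : Prop :=
  forall T : LensSpan A B, P T ->
    exists! L : Lens (apex T) (apex S),
      lens_comp (lleg S) L = lleg T /\ lens_comp (rleg S) L = rleg T.

(* Main.v *)
Require Import Defs.

Set Implicit Arguments.
Unset Strict Implicit.

(** The idea is to test terminality on the sync-minimal core [M] of the proxy
    pullback [D] itself.  Compatibility is inherited by [M], because its legs
    take the same values as those of [D] ([compatible_core]); and [M] is
    independent, because a morphism of a pullback is determined by its two
    projections ([pullback_jointly_faithful], [independent_core_core]).  So
    terminality yields a lens [L] from [M] to [D] over [A] and [B].

    The get functor of [L] and the inclusion of [M] in [D] have the same
    composites with the projections of the pullback, so they coincide.  But an
    identity-on-objects inclusion can be the get functor of a lens only if it is
    full: the lift of a morphism [d] of [D] is a morphism of [M] whose image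
    under the inclusion is [d].  Hence every morphism of [D] lies in [M], that
    is, it is a composite of lifts. *)

Inductive arrow_mor : Type := arrow_src | arrow_tgt | arrow_gen.

(** The category with two objects, [false] and [true], and one non-identity
    morphism, [arrow_gen] from [false] to [true]: functors out of it are
    morphisms, so it turns the universal property of a pullback into a statement
    on morphisms. *)
Definition walking_arrow : Category.
Proof.
refine {| Ob := bool; Mor := arrow_mor;
          dom := fun m => match m with arrow_tgt => true | _ => false end;
          cod := fun m => match m with arrow_src => false | _ => true end;
          idm := fun b : bool => if b then arrow_tgt else arrow_src;
          (* If [f] is not the identity of [false], it ends at [true], so [g] is
             the identity of [true]. *)
          comp := fun g f _ => match f with
                               | arrow_src => g
                               | _ => f
                               end |}.
- now intros [].
- now intros [].
- intros [] []; simpl; congruence.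
- intros [] []; simpl; congruence.
- now intros [].
- now intros [].
- intros [] [] []; simpl; congruence.
Defined.

Lemma comp_idm_idm (C : Category) (X : Ob C) (p : cod (idm X) = dom (idm X)) :
  comp (idm X) (idm X) p = idm X.
Proof.
assert (r : cod (idm (dom (idm X))) = dom (idm X)) by apply cod_idm.
transitivity (comp (idm X) (idm (dom (idm X))) r); [| apply comp_idr].
apply comp_eq; [| rewrite dom_idm]; reflexivity.
Qed.

Definition arrow_functor (D : Category) (d : Mor D) : Functor walking_arrow D.
Proof.
refine {| fobj := fun b : Ob walking_arrow => if b then cod d else dom d;
          fmor := fun m : Mor walking_arrow =>
            match m with
            | arrow_src => idm (dom d)
            | arrow_tgt => idm (cod d)
            | arrow_gen => d
            end |}.
- intros []; simpl; auto using dom_idm.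
- intros []; simpl; auto using cod_idm.
- now intros [].
- intros g f p q.
  destruct g, f; simpl in *; try discriminate; symmetry.
  + apply comp_idm_idm.
  + apply comp_idm_idm.
  + apply comp_idl.
  + apply comp_idr.
Defined.

Lemma pullback_functor_unique (A B C D X : Category)
  (F : Functor A C) (G : Functor B C) (P : Functor D A) (Q : Functor D B)
  (U V : Functor X D) :
  is_pullback F G P Q ->
  functor_comp P U = functor_comp P V ->
  functor_comp Q U = functor_comp Q V ->
  U = V.
Proof.
intros [HFG Huniv] HP HQ.
assert (HV : functor_comp F (functor_comp P V) = functor_comp G (functor_comp Q V)).
{ apply functor_ext.
  - intros x; exact (f_equal (fun H => fobj H (fobj V x)) HFG).
  - intros m; exact (f_equal (fun H => fmor H (fmor V m)) HFG). }
destruct (Huniv X _ _ HV) as [W [_ HW]].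
transitivity W; [symmetry |]; apply HW; auto.
Qed.

Lemma pullback_jointly_faithful (A B C D : Category)
  (F : Functor A C) (G : Functor B C) (P : Functor D A) (Q : Functor D B)
  (d d' : Mor D) :
  is_pullback F G P Q ->
  fmor P d = fmor P d' -> fmor Q d = fmor Q d' -> d = d'.
Proof.
intros Hpb HP HQ.
assert (agree : forall (T : Category) (H : Functor D T), fmor H d = fmor H d' ->
  functor_comp H (arrow_functor d) = functor_comp H (arrow_functor d')).
{ intros T H E.
  assert (Ed : fobj H (dom d) = fobj H (dom d')) by (rewrite <- !dom_fmor; congruence).
  assert (Ec : fobj H (cod d) = fobj H (cod d')) by (rewrite <- !cod_fmor; congruence).
  apply functor_ext; intros []; simpl; rewrite ?fmor_idm; congruence. }
assert (E := pullback_functor_unique Hpb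
               (agree _ P HP) (agree _ Q HQ)).
exact (f_equal (fun U : Functor walking_arrow D => fmor U arrow_gen) E).
Qed.

Definition core_inclusion (A B : Category) (S : LensSpan A B) :
  Functor (apex (sync_minimal_core S)) (apex S).
Proof.
refine {| fobj := fun X : Ob (apex (sync_minimal_core S)) => X : Ob (apex S);
          fmor := fun c : Mor (apex (sync_minimal_core S)) => proj1_sig c |}.
- reflexivity.
- reflexivity.
- reflexivity.
- intros g f p q; apply comp_eq; reflexivity.
Defined.

Lemma composite_weaken (C : Category) (P Q : Mor C -> Prop) (c : Mor C) :
  (forall d, P d -> Q d) -> composite P c -> composite Q c.
Proof. intros HPQ Hc; induction Hc; constructor; auto. Qed.

Lemma is_lift_lift_of_image (C A : Category) (F : Lens C A) (c : Mor C) :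
  is_lift F c -> lift_of_image F c.
Proof.
intros (X & a & p & ->); apply lift_eq; symmetry; [apply dom_lift | apply get_lift].
Qed.

Lemma lift_congr (A B : Category) (F G : Lens A B) (X : Ob A) (b : Mor B)
  (p : dom b = fobj F X) (q : dom b = fobj G X) :
  F = G -> lift F X b p = lift G X b q.
Proof. intros <-; now apply lift_eq. Qed.

Lemma compatible_core (A B C : Category) (F : Lens A C) (G : Lens B C)
  (S : LensSpan A B) :
  compatible F G S -> compatible F G (sync_minimal_core S).
Proof.
intros [Hcomm [HK HJ]]; split; [| split].
- apply lens_ext.
  + apply functor_ext.
    * intros X; exact (f_equal (fun L : Lens (apex S) C => fobj L X) Hcomm).
    * intros c; exact (f_equal (fun L : Lens (apex S) C => fmor L (proj1_sig c)) Hcomm).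
  + intros X c p q; apply sig_ext.
    exact (@lift_congr _ _ (lens_comp F (lleg S)) (lens_comp G (rleg S)) X c p q Hcomm).
- intros E a p q; exact (HK E a p q).
- intros E b p q; exact (HJ E b p q).
Qed.

(** Independence of the core concerns the core of the core, whose morphisms are
    still morphisms of the original apex with the same images. *)
Lemma independent_core_core (A B C : Category) (F : Functor A C) (G : Functor B C)
  (S : LensSpan A B) :
  is_pullback F G (lleg S) (rleg S) -> independent (sync_minimal_core S).
Proof.
intros Hpb c c' _ Hl Hr; do 2 apply sig_ext.
exact (pullback_jointly_faithful Hpb Hl Hr).
Qed.

(** A lens whose get functor is the inclusion of the core forces the core to be
    everything, since each lift is a preimage. *)
Lemma sync_minimal_of_core_lens (A B : Category) (S : LensSpan A B)
  (L : Lens (apex (sync_minimal_core S)) (apex S)) :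
  get L = core_inclusion S -> sync_minimal S.
Proof.
intros HL d.
assert (p : dom d = fobj L (dom d)) by now rewrite HL.
assert (E := get_lift p); rewrite HL in E; simpl in E.
rewrite <- E.
apply composite_weaken with (2 := proj2_sig (lift L (dom d) d p)).
intros c [Hc | Hc]; [left | right]; now apply is_lift_lift_of_image.
Qed.

Theorem theorem6p2 (A B C D : Category)
  (F : Lens A C) (G : Lens B C) (Gbar : Lens D A) (Fbar : Lens D B)
  (Hproxy : proxy_pullback F G (Span Gbar Fbar))
  (Hterminal : terminal_amongst
     (fun S : LensSpan A B => independent S /\ compatible F G S)
     (Span Gbar Fbar)) :
  sync_minimal (Span Gbar Fbar).
Proof.
destruct Hproxy as [Hcompat Hpb].
destruct (Hterminal (sync_minimal_core (Span Gbar Fbar))) as [L [[HA HB] _]].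
{ split; [exact (independent_core_core (S := Span Gbar Fbar) Hpb) | now apply compatible_core]. }
apply (sync_minimal_of_core_lens (L := L)).
assert (proj : forall (T : Category) (H : Lens D T) K, lens_comp H L = K ->
  get K = functor_comp H (core_inclusion (Span Gbar Fbar)) ->
  functor_comp H L = functor_comp H (core_inclusion (Span Gbar Fbar))).
{ intros T H K HK E; now rewrite <- E, <- HK. }
apply (pullback_functor_unique Hpb);
  [apply (proj _ _ _ HA) | apply (proj _ _ _ HB)]; now apply functor_ext.
Qed.
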